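(* Let $n,m,k$ be positive integers, let $I_1,\dots,I_k\subseteq\{1,\dots,n\}$ be pairwise disjoint sets with $|I_i|\le m$, and let $f\colon\{0,1\}^n\to[-1,1]$ be given by $f(x)=\prod_{i=1}^k f_i(x_{I_i})$ for functions $f_i$ with range in $[-1,1]$. Then for every positive integer $d$, \[ W_{1,d}[f]\le\bigl(85\sqrt{m\ln(4ek)}\bigr)^d. \]
   Context: For $x\in\{0,1\}^n$ and $I\subseteq[n]$, $x_I$ denotes the $|I|$ bits of $x$ indexed by $I$. For $f\colon\{0,1\}^n\to\mathbb{C}$ and $S\subseteq[n]$, $\chi_S(x)=(-1)^{\sum_{i\in S}x_i}$ and $\hat f_S=\mathbb{E}_x[f(x)\chi_S(x)]$ with $x$ uniform, so $f=\sum_S\hat f_S\chi_S$. The $d$th level Fourier weight in $L_q$-norm is $W_{q,d}[f]:=\sum_{|S|=d}|\hat f_S|^q$. *)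

(* Defs.v *)
From HB Require Import structures.
From mathcomp Require Import all_boot all_order all_algebra.
From mathcomp Require Import all_classical all_reals all_analysis.

Set Implicit Arguments.
Unset Strict Implicit.
Unset Printing Implicit Defensive.

Import Order.TTheory GRing.Theory Num.Theory.

Local Open Scope ring_scope.

Notation cube n := {ffun 'I_n -> bool}.

(* The cube {0,1}^I, whose coordinates are the elements of I themselves. *)
Notation subcube I := {ffun {j | j \in I} -> bool}.

Definition cube_restrict (n : nat) (x : cube n) (I : {set 'I_n}) : subcube I :=
  [ffun j : {j | j \in I} => x (val j)].

Section Fourier.
Variables (R : realType) (n : nat).

Definition chi (S : {set 'I_n}) (x : cube n) : R :=
  (-1) ^+ (\sum_(i in S) (x i : nat))%N.

Definition expect (g : cube n -> R) : R :=
  (#|{: cube n}|%:R)^-1 * \sum_(x : cube n) g x.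

Definition fourier (f : cube n -> R) (S : {set 'I_n}) : R :=
  expect (fun x => f x * chi S x).

Definition fourier_weight (q : R) (d : nat) (f : cube n -> R) : R :=
  \sum_(S : {set 'I_n} | #|S| == d) `|fourier f S| `^ q.

End Fourier.

(* Main.v *)
Require Import Defs.
From HB Require Import structures.
From mathcomp Require Import all_boot all_order all_algebra.
From mathcomp Require Import all_classical all_reals all_analysis.
From mathcomp Require Import ring lra.

Set Implicit Arguments.
Unset Strict Implicit.
Unset Printing Implicit Defensive.

Import Order.TTheory GRing.Theory Num.Theory.

Local Open Scope ring_scope.

(* Write [mass z F] for the sum of |F^_S| z^|S|, so that W_{1,d}[f] <= z^-d mass z f.
   Factors depending on disjoint sets of coordinates have a submultiplicative mass, so
   it is enough that mass z F_i <= 1 + 1/(2k) for z = 1 / (28 sqrt(m L)), L = ln(4ek).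
   Up to the sign of F_i, the function g = (1 - F_i)/2 takes values in [0,1] and has mean
   a <= 1/2, and the claim becomes: the sum of |g^_S| z^|S| over nonempty S is at most
   a + 1/(4k). By Cauchy-Schwarz (as AM-GM) over the S in I_i this sum is at most a tenth
   of the L_2 norm of T_rho g with rho^2 = 1/(4L), and hypercontractivity with exponent
   p = 1 + 1/L bounds the norm by a^(1/p), hence by 10 (a + 1/(4k)). The two-point
   inequality behind it has the non-sharp constant rho^2 = (p - 1)/4 in place of the
   optimal p - 1, which makes it elementary. *)

(** * Fourier analysis on the cube and the action of coordinate flips *)

Section FourierBasics.
Context {R : realType} {n : nat}.
Implicit Types (f g h : cube n -> R) (S T U : {set 'I_n}) (x y : cube n).

(** Independence of a function from coordinate [j] is expressed throughout as [f \o flip j =1 f]. *)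
Definition flip (j : 'I_n) (x : cube n) : cube n :=
  [ffun i => if i == j then ~~ x i else x i].

Lemma flipK j : involutive (flip j).
Proof. by move=> x; apply/ffunP => i; rewrite !ffunE; case: eqP; rewrite ?negbK. Qed.

Lemma chi_prod S x : chi R S x = \prod_(i in S) (-1) ^+ x i.
Proof. by rewrite /chi expr_sum. Qed.

Lemma chi0 x : chi R finset.set0 x = 1.
Proof. by rewrite /chi big_set0. Qed.

Lemma chi_flip j S x : chi R S (flip j x) = (-1) ^+ (j \in S) * chi R S x.
Proof.
have notj T (i : 'I_n) : i \in T :\ j -> (-1) ^+ flip j x i = (-1) ^+ x i :> R.
  by rewrite !inE => /andP[/negbTE ij _]; rewrite ffunE ij.
rewrite !chi_prod; case: (boolP (j \in S)) => jS.
  rewrite (big_setD1 j) //= [in RHS](big_setD1 j) //= (eq_bigr _ (notj S)) ffunE eqxx.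
  by case: (x j); rewrite /= ?expr0 ?expr1; ring.
rewrite expr0 mul1r; apply: eq_bigr => i iS; rewrite ffunE.
by case: eqP => // ij; rewrite -ij iS in jS.
Qed.

Lemma card_cube_neq0 : #|{: cube n}|%:R != 0 :> R.
Proof. by rewrite card_ffun card_bool pnatr_eq0 expn_eq0. Qed.

Lemma expect_cst (c : R) : expect (fun _ : cube n => c) = c.
Proof. by rewrite /expect sumr_const -[c *+ _]mulr_natl mulKf // card_cube_neq0. Qed.

Lemma eq_expect f g : f =1 g -> expect f = expect g.
Proof. by move=> fg; rewrite /expect; under eq_bigr do rewrite fg. Qed.

Lemma expectD f g : expect (fun x => f x + g x) = expect f + expect g.
Proof. by rewrite /expect big_split mulrDr. Qed.

Lemma expectZ (c : R) f : expect (fun x => c * f x) = c * expect f.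
Proof. by rewrite /expect -mulr_sumr mulrCA. Qed.

Lemma expect_sum (J : finType) (F : J -> cube n -> R) :
  expect (fun x => \sum_i F i x) = \sum_i expect (F i).
Proof. by rewrite /expect exchange_big mulr_sumr. Qed.

Lemma expect_le f g : (forall x, f x <= g x) -> expect f <= expect g.
Proof. by move=> fg; rewrite ler_wpM2l ?invr_ge0 //; apply: ler_sum. Qed.

Lemma expect_flip j f : expect (f \o flip j) = expect f.
Proof. by rewrite /expect [in RHS](reindex_inj (can_inj (flipK j))). Qed.

(** Flipping a coordinate of a nonempty [S] negates the character but preserves its mean, which is
    therefore its own negative. *)
Lemma expect_chi S : expect (chi R S) = (S == finset.set0)%:R.
Proof.
case: (set_0Vmem S) => [->|[j jS]].
  by rewrite eqxx (eq_expect (g := fun=> 1)) ?expect_cst // => x; rewrite chi0.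
have -> : (S == finset.set0) = false by apply/set0Pn; exists j.
have := expect_flip j (chi R S).
rewrite (eq_expect (g := fun x => -1 * chi R S x)); last first.
  by move=> x; rewrite /= chi_flip jS.
by rewrite expectZ mulr0n => H; lra.
Qed.

Lemma chiM S T x : chi R S x * chi R T x = chi R ((S :\: T) :|: (T :\: S)) x.
Proof.
rewrite !chi_prod [X in X * _]big_mkcond [X in _ * X]big_mkcond -big_split.
rewrite [RHS]big_mkcond; apply: eq_bigr => i _; rewrite !inE.
by case: (i \in S); case: (i \in T); rewrite /= ?mulr1 ?mul1r // -expr2 sqrr_sign.
Qed.

Lemma fourier_chi S T : fourier (chi R T) S = (S == T)%:R.
Proof.
rewrite /fourier (eq_expect (chiM T S)) expect_chi finset.setU_eq0 !finset.setD_eq0.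
by rewrite eq_sym finset.eqEsubset andbC.
Qed.

Lemma sum_prod_set (c : 'I_n -> R) :
  \sum_(S : {set 'I_n}) \prod_(i in S) c i = \prod_i (1 + c i).
Proof.
under [RHS]eq_bigr do rewrite addrC.
rewrite bigA_distr; by apply: eq_bigr => S _; rewrite [LHS]big_mkcond.
Qed.

Lemma fourier_inversion f x : f x = \sum_S fourier f S * chi R S x.
Proof.
(* The sum over [S] factors over the coordinates as the product of 1 + (-1)^(y_i + x_i): each factor
   is 2 when y = x, and some factor vanishes otherwise. *)
have key y : \sum_S chi R S y * chi R S x = #|{: cube n}|%:R * (y == x)%:R.
  under eq_bigr do rewrite !chi_prod -big_split.
  rewrite sum_prod_set; case: eqP => [->|/eqP nyx].
    rewrite mulr1 (eq_bigr (fun=> 2)) ?prodr_const ?card_ffun ?card_bool ?natrX //.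
    by move=> i _; rewrite /= -expr2 sqrr_sign.
  have [i nyxi] : exists i, y i != x i.
    apply/existsP; apply: contraNT nyx; rewrite negb_exists => /forallP H.
    by apply/eqP/ffunP => i; have /negPn/eqP := H i.
  rewrite (bigD1 i) //=; move: nyxi; case: (y i); case: (x i) => //= _;
  by rewrite expr1 expr0 ?mulr1 ?mul1r subrr mul0r mulr0.
under eq_bigr do rewrite mulrC /fourier -expectZ.
rewrite -expect_sum /expect.
transitivity (#|{: cube n}|%:R^-1 * \sum_y f y * (#|{: cube n}|%:R * (y == x)%:R)).
  rewrite (bigD1 x) //= big1 ?addr0 => [|y /negbTE ->]; last by rewrite !mulr0.
  by rewrite eqxx mulr1 mulrC mulfK // card_cube_neq0.
congr (_ * _); apply: eq_bigr => y _; rewrite -key mulr_sumr.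
by apply: eq_bigr => S _; ring.
Qed.

Lemma parseval f : expect (fun x => f x ^+ 2) = \sum_S fourier f S ^+ 2.
Proof.
transitivity (expect (fun x => \sum_S fourier f S * (f x * chi R S x))).
  apply: eq_expect => x; rewrite expr2 {2}fourier_inversion mulr_sumr.
  by apply: eq_bigr => S _; rewrite mulrCA.
by rewrite expect_sum; apply: eq_bigr => S _; rewrite expectZ expr2.
Qed.

Lemma fourier_set0 f : fourier f finset.set0 = expect f.
Proof. by apply: eq_expect => x; rewrite chi0 mulr1. Qed.

Lemma fourier_flip j f S : fourier (f \o flip j) S = (-1) ^+ (j \in S) * fourier f S.
Proof.
rewrite /fourier -(expect_flip j) -expectZ; apply: eq_expect => x /=.
by rewrite flipK chi_flip; ring.
Qed.

Lemma fourierD f g S : fourier (fun x => f x + g x) S = fourier f S + fourier g S.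
Proof. by rewrite /fourier -expectD; apply: eq_expect => x; rewrite mulrDl. Qed.

Lemma fourierZ (c : R) f S : fourier (fun x => c * f x) S = c * fourier f S.
Proof. by rewrite /fourier -expectZ; apply: eq_expect => x; rewrite mulrA. Qed.

Lemma fourier_sum (J : finType) (F : J -> cube n -> R) S :
  fourier (fun x => \sum_i F i x) S = \sum_i fourier (F i) S.
Proof. by rewrite /fourier -expect_sum; apply: eq_expect => x; rewrite mulr_suml. Qed.

Lemma eq_fourier f g S : f =1 g -> fourier f S = fourier g S.
Proof. by move=> fg; apply: eq_expect => x; rewrite fg. Qed.

(** Together, [avg j] and [halfdiff j] split [f] into its Fourier terms with [j \notin S] and those
    with [j \in S]; noise at coordinate [j] damps only the latter. *)
Definition avg j f x := (f x + f (flip j x)) / 2.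

Definition halfdiff j f x := (f x - f (flip j x)) / 2.

Lemma fourier_avg j f S : fourier (avg j f) S = (j \notin S)%:R * fourier f S.
Proof.
rewrite (eq_fourier (g := fun x => 2^-1 * (f x + (f \o flip j) x))); last first.
  by move=> x; rewrite mulrC.
rewrite fourierZ fourierD fourier_flip.
by case: (j \in S); rewrite /= ?expr1 ?expr0; field.
Qed.

Lemma fourier_halfdiff j f S : fourier (halfdiff j f) S = (j \in S)%:R * fourier f S.
Proof.
rewrite (eq_fourier (g := fun x => 2^-1 * (f x + -1 * (f \o flip j) x))); last first.
  by move=> x; rewrite mulrC mulN1r.
rewrite fourierZ fourierD fourierZ fourier_flip.
by case: (j \in S); rewrite /= ?expr1 ?expr0; field.
Qed.

Lemma fourier_eq0 j f S : f \o flip j =1 f -> j \in S -> fourier f S = 0.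
Proof.
move=> fj jS; have := fourier_flip j f S.
by rewrite (eq_fourier _ fj) jS expr1 => H; lra.
Qed.

End FourierBasics.

(** * Real inequalities leading to the two-point inequality *)

Section RealInequalities.
Context {R : realType}.
Implicit Types (a b p r t y : R).

(** This is the triangle inequality for a weighted Euclidean norm on the plane. Squaring reduces it
    to Cauchy-Schwarz, whose defect is r (a1 b2 - a2 b1)^2. *)
Lemma minkowski2 r (a1 a2 b1 b2 : R) : 0 <= r -> 0 <= a1 -> 0 <= a2 -> 0 <= b1 -> 0 <= b2 ->
  Num.sqrt ((a1 + a2) ^+ 2 + r * (b1 + b2) ^+ 2)
    <= Num.sqrt (a1 ^+ 2 + r * b1 ^+ 2) + Num.sqrt (a2 ^+ 2 + r * b2 ^+ 2).
Proof.
move=> r0 a10 a20 b10 b20.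
set u := a1 ^+ 2 + _; set v := a2 ^+ 2 + _.
have u0 : 0 <= u by rewrite addr_ge0 ?mulr_ge0 ?sqr_ge0.
have v0 : 0 <= v by rewrite addr_ge0 ?mulr_ge0 ?sqr_ge0.
rewrite -[leRHS](ger0_norm (addr_ge0 (sqrtr_ge0 _) (sqrtr_ge0 _))) -sqrtr_sqr.
rewrite ler_sqrt ?sqr_ge0 // [leRHS]sqrrD !sqr_sqrtr // -sqrtrM //.
have cs : a1 * a2 + r * (b1 * b2) <= Num.sqrt (u * v).
  rewrite -[leLHS]ger0_norm ?addr_ge0 ?mulr_ge0 // -sqrtr_sqr ler_sqrt ?mulr_ge0 //.
  rewrite -subr_ge0 [X in 0 <= X](_ : _ = r * (a1 * b2 - a2 * b1) ^+ 2).
    by rewrite mulr_ge0 ?sqr_ge0.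
  by rewrite /u /v; ring.
have -> : (a1 + a2) ^+ 2 + r * (b1 + b2) ^+ 2 = u + v + (a1 * a2 + r * (b1 * b2)) *+ 2.
  by rewrite /u /v; ring.
by rewrite mulr2n; lra.
Qed.

(* [y^(p-1) >= 1 + (p-1) ln y], and [ln y = - 2 ln (1 / sqrt y) >= 2 - 2 / sqrt y]. *)
Lemma powR_ge_sqrt p y : 1 <= p -> 0 <= y ->
  y + 2 * (p - 1) * (y - Num.sqrt y) <= y `^ p.
Proof.
move=> p1; rewrite le_eqVlt => /predU1P[<-|y0].
  by rewrite sqrtr0 subrr mulr0 addr0 powR_ge0.
have s0 : 0 < Num.sqrt y by rewrite sqrtr_gt0.
have sy : Num.sqrt y * Num.sqrt y = y by rewrite -expr2 sqr_sqrtr // ltW.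
have lny : 2 * (1 - (Num.sqrt y)^-1) <= ln y.
  rewrite -[in leRHS]sy lnM ?posrE //.
  have := @le_ln1Dx _ ((Num.sqrt y)^-1 - 1).
  rewrite (addrC 1) subrK lnV ?posrE // ltrBrDr addNr invr_gt0 => /(_ s0).
  lra.
have -> : p = 1 + (p - 1) by ring.
rewrite powRD ?(gt_eqF y0) ?implybT // powRr1 ?(ltW y0) //.
have e1 : 1 + (p - 1) * ln y <= y `^ (p - 1).
  by rewrite /powR gt_eqF // expR_ge1Dx.
have h : 1 + (p - 1) * (2 * (1 - (Num.sqrt y)^-1)) <= y `^ (p - 1).
  apply: le_trans e1; rewrite lerD2l ler_wpM2l //; lra.
have := ler_wpM2l (ltW y0) h.
suff -> : y * (1 + (p - 1) * (2 * (1 - (Num.sqrt y)^-1)))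
  = y + 2 * (1 + (p - 1) - 1) * (y - Num.sqrt y) by [].
move: (Num.sqrt y) s0 sy => s s0 <-; field; exact: lt0r_neq0.
Qed.

(** The square of the left side is 2 + 2 sqrt(1 - t^2) <= 4 - t^2, while that of the right side is 4
    - t^2 + t^4/16. *)
Lemma sqrt_sum_le t : t ^+ 2 <= 1 -> Num.sqrt (1 + t) + Num.sqrt (1 - t) <= 2 - t ^+ 2 / 4.
Proof.
move=> t1.
have tb : -1 <= t <= 1 by apply/andP; split; nra.
have t0 := sqr_ge0 t; have t4 := sqr_ge0 (t ^+ 2).
have s1 : Num.sqrt (1 + t) ^+ 2 = 1 + t by rewrite sqr_sqrtr //; lra.
have s2 : Num.sqrt (1 - t) ^+ 2 = 1 - t by rewrite sqr_sqrtr //; lra.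
have p1 := sqrtr_ge0 (1 + t); have p2 := sqrtr_ge0 (1 - t).
set u : R := Num.sqrt (1 + t) in s1 p1 *; set v : R := Num.sqrt (1 - t) in s2 p2 *.
have uv : u * v <= 1 - t ^+ 2 / 2.
  rewrite -ler_sqr ?nnegrE ?mulr_ge0 //; last lra.
  by rewrite exprMn s1 s2; nra.
rewrite -ler_sqr ?nnegrE ?(addr_ge0 p1 p2) //; last lra.
by rewrite sqrrD s1 s2 -mulr_natr; nra.
Qed.

(** Scale to a = c(1 + t), b = c(1 - t). The left side becomes c^p w^(p/2) with w = 1 + (p - 1) t^2
    / 4, and w^(p/2) <= w because w >= 1 and p <= 2. Averaging [powR_ge_sqrt] at 1 + t and 1 - t and
    applying [sqrt_sum_le] gives exactly w as a lower bound for the right side over c^p; this fixes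
    the constant 1/4. *)
Lemma two_point p a b : 1 <= p <= 2 -> 0 <= a -> 0 <= b ->
  Num.sqrt (((a + b) / 2) ^+ 2 + (p - 1) / 4 * ((a - b) / 2) ^+ 2) `^ p
    <= (a `^ p + b `^ p) / 2.
Proof.
move=> /andP[p1 p2] a0 b0.
have [ab0|abN] := eqVneq (a + b) 0.
  have -> : a = 0 by lra.
  have -> : b = 0 by lra.
  rewrite addr0 subrr mul0r expr0n /= mulr0 addr0 sqrtr0 powR0 ?addr0 ?mul0r //.
  by rewrite gt_eqF; lra.
pose c := (a + b) / 2; pose t := (a - b) / (a + b).
have c0 : 0 < c by rewrite divr_gt0 // lt_neqAle eq_sym abN addr_ge0.
have ac : a = c * (1 + t) by rewrite /c /t; field.
have bc : b = c * (1 - t) by rewrite /c /t; field.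
have t1 : -1 <= t by rewrite -(ler_pM2l c0) -subr_ge0; lra.
have t2 : t <= 1 by rewrite -(ler_pM2l c0) -subr_ge0; lra.
have tt : t ^+ 2 <= 1 by nra.
have t0 := sqr_ge0 t.
set w := 1 + (p - 1) / 4 * t ^+ 2.
have w1 : 1 <= w by rewrite lerDl mulr_ge0 // divr_ge0 //; lra.
rewrite [X in Num.sqrt X](_ : _ = c ^+ 2 * w); last by rewrite ac bc /w; field.
rewrite sqrtrM ?sqr_ge0 // sqrtr_sqr ger0_norm ?(ltW c0) //.
have p0 : 0 <= 1 + t /\ 0 <= 1 - t by lra.
rewrite ac bc (powRM _ (ltW c0) (sqrtr_ge0 w)) (powRM _ (ltW c0) p0.1) (powRM _ (ltW c0) p0.2).
rewrite -mulrDr -[leRHS]mulrA ler_wpM2l ?powR_ge0 //.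
have s1 : 1 <= Num.sqrt w by rewrite -[leLHS]sqrtr1 ler_sqrt //; lra.
have sw : Num.sqrt w `^ 2%:R = w by rewrite powR_mulrn ?sqrtr_ge0 // sqr_sqrtr //; lra.
apply: (@le_trans _ _ w).
  by apply: le_trans (ler_powR s1 p2) _; rewrite sw.
have := @powR_ge_sqrt p (1 + t) p1; have := @powR_ge_sqrt p (1 - t) p1.
have := sqrt_sum_le tt => h3 h2 h1.
have {}h1 := h1 ltac:(lra); have {}h2 := h2 ltac:(lra).
have := @ler_wpM2l _ (p - 1) ltac:(lra) _ _ h3.
rewrite /w; lra.
Qed.

End RealInequalities.

(** * The noise operator and hypercontractivity *)

Section Hypercontractivity.
Context {R : realType} {n : nat}.
Implicit Types (f g h u v : cube n -> R) (S : {set 'I_n}) (x : cube n) (s : seq 'I_n).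

(* When [s] lists all coordinates this is the squared L_2 norm of the noise operator
   with rho^2 = r applied to g; processing the coordinates one at a time turns the
   tensorization of the two-point inequality into an induction on [s]. *)
Fixpoint noise_form (r : R) s g x :=
  if s is j :: s' then noise_form r s' (avg j g) x + r * noise_form r s' (halfdiff j g) x
  else g x ^+ 2.

(** The mean over the coordinates in [s] is kept as a function of the point, so that the induction
    on [s] can compare both sides at a fixed [x]. *)
Fixpoint avgs s g := if s is j :: s' then avgs s' (avg j g) else g.

Lemma noise_form_ge0 r s g x : 0 <= r -> 0 <= noise_form r s g x.
Proof.
by move=> r0; elim: s g => [|j s IH] g /=; rewrite ?sqr_ge0 // addr_ge0 ?mulr_ge0.
Qed.

Lemma avgD j u v : avg j (fun x => u x + v x) = (fun x => avg j u x + avg j v x).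
Proof. by apply/funext => x; rewrite /avg; field. Qed.

Lemma avgZ j (c : R) u : avg j (fun x => c * u x) = (fun x => c * avg j u x).
Proof. by apply/funext => x; rewrite /avg; field. Qed.

Lemma halfdiffD j u v :
  halfdiff j (fun x => u x + v x) = (fun x => halfdiff j u x + halfdiff j v x).
Proof. by apply/funext => x; rewrite /halfdiff; field. Qed.

Lemma halfdiffZ j (c : R) u : halfdiff j (fun x => c * u x) = (fun x => c * halfdiff j u x).
Proof. by apply/funext => x; rewrite /halfdiff; field. Qed.

Lemma noise_formZ r s (c : R) u x :
  noise_form r s (fun x => c * u x) x = c ^+ 2 * noise_form r s u x.
Proof.
elim: s u => [|j s IH] u /=; first by rewrite exprMn.
by rewrite avgZ halfdiffZ !IH; ring.
Qed.

Lemma noise_form_parallelogram r s u v x :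
  noise_form r s (fun x => u x + v x) x + noise_form r s (fun x => u x + -1 * v x) x
    = 2 * (noise_form r s u x + noise_form r s v x).
Proof.
elim: s u v => [|j s IH] u v /=; first by ring.
by rewrite !avgD !halfdiffD avgZ halfdiffZ addrACA -mulrDr !IH; ring.
Qed.

(** The recursion makes the norm of [u] a weighted Euclidean norm of the pair of norms of [avg j u]
    and [halfdiff j u]. The induction hypothesis bounds each entry of the pair for the sum, and
    [minkowski2] combines them. *)
Lemma noise_form_triangle r s u v x : 0 <= r ->
  Num.sqrt (noise_form r s (fun x => u x + v x) x)
    <= Num.sqrt (noise_form r s u x) + Num.sqrt (noise_form r s v x).
Proof.
move=> r0; elim: s u v => [|j s IH] u v /=.
  by rewrite !sqrtr_sqr ler_normD.
rewrite avgD halfdiffD.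
have sq w : Num.sqrt (noise_form r s w x) ^+ 2 = noise_form r s w x.
  by rewrite sqr_sqrtr ?noise_form_ge0.
have := minkowski2 r0 (sqrtr_ge0 (noise_form r s (avg j u) x))
  (sqrtr_ge0 (noise_form r s (avg j v) x)) (sqrtr_ge0 (noise_form r s (halfdiff j u) x))
  (sqrtr_ge0 (noise_form r s (halfdiff j v) x)).
rewrite !sq; apply: le_trans; rewrite ler_sqrt; last first.
  by rewrite addr_ge0 ?mulr_ge0 ?sqr_ge0.
by rewrite -sq -[noise_form r s (fun x => halfdiff _ _ _ + _) x]sq lerD ?ler_wpM2l //
  ler_sqr ?nnegrE ?addr_ge0 ?sqrtr_ge0.
Qed.

Lemma avgsD s u v x : avgs s (fun x => u x + v x) x = avgs s u x + avgs s v x.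
Proof. by elim: s u v => //= j s IH u v; rewrite avgD IH. Qed.

Lemma avgsZ s (c : R) u x : avgs s (fun x => c * u x) x = c * avgs s u x.
Proof. by elim: s u => //= j s IH u; rewrite avgZ IH. Qed.

(* By the parallelogram law and the triangle inequality, the step at coordinate
   [j] reduces to the two-point inequality for the norms of [g] and [g \o flip j]. *)
Lemma hypercontractive (p : R) s g x : 1 <= p <= 2 ->
  Num.sqrt (noise_form ((p - 1) / 4) s g x) `^ p <= avgs s (fun y => `|g y| `^ p) x.
Proof.
move=> p12; have /andP[p1 p2] := p12; set r := (p - 1) / 4.
have r0 : 0 <= r by rewrite divr_ge0 //; lra.
have r1 : r <= 1 by rewrite /r; lra.
elim: s g => [|j s IH] g /=; first by rewrite sqrtr_sqr.
pose g' := g \o flip j.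
have -> : avg j (fun y => `|g y| `^ p)
  = (fun y => 2^-1 * (`|g y| `^ p + `|g' y| `^ p)).
  by apply/funext => y; rewrite mulrC.
rewrite avgsZ avgsD.
have := IH g; have := IH g'.
set b := Num.sqrt (noise_form r s g' x); set a := Num.sqrt (noise_form r s g x).
move=> hb ha.
have a0 : 0 <= a := sqrtr_ge0 _; have b0 : 0 <= b := sqrtr_ge0 _.
apply: (@le_trans _ _ ((a `^ p + b `^ p) / 2)); last first.
  by rewrite mulrC ler_wpM2l ?invr_ge0 // lerD.
apply: le_trans (two_point p12 a0 b0).
apply: ge0_ler_powR; rewrite ?nnegrE ?sqrtr_ge0 //; first by lra.
have ab0 : 0 <= ((a + b) / 2) ^+ 2 + r * ((a - b) / 2) ^+ 2.
  by rewrite addr_ge0 ?sqr_ge0 ?(mulr_ge0 r0) ?sqr_ge0.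
rewrite ler_sqrt //.
have sa : noise_form r s g x = a ^+ 2 by rewrite sqr_sqrtr ?noise_form_ge0.
have sb : noise_form r s g' x = b ^+ 2 by rewrite sqr_sqrtr ?noise_form_ge0.
have par := noise_form_parallelogram r s (avg j g) (halfdiff j g) x.
have e1 : (fun x => avg j g x + halfdiff j g x) = g.
  by apply/funext => y; rewrite /avg /halfdiff; field.
have e2 : (fun x => avg j g x + -1 * halfdiff j g x) = g'.
  by apply/funext => y; rewrite /avg /halfdiff /g' /=; field.
rewrite e1 e2 sa sb in par.
have tri : noise_form r s (avg j g) x <= ((a + b) / 2) ^+ 2.
  have -> : avg j g = (fun x => 2^-1 * (g x + g' x)).
    by apply/funext => y; rewrite mulrC.
  rewrite noise_formZ expr_div_n mulrC -exprVn ler_wpM2r ?sqr_ge0 //.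
  rewrite -[leLHS]sqr_sqrtr ?noise_form_ge0 //.
  by rewrite ler_sqr ?nnegrE ?sqrtr_ge0 ?addr_ge0 // noise_form_triangle.
(* The parallelogram law turns A + r D into (1 - r) A + r (a^2 + b^2)/2, so the upper bound on A
   suffices because r <= 1. *)
have := @ler_wpM2l _ (1 - r) ltac:(lra) _ _ tri.
set A := noise_form r s (avg j g) x in par *.
set D := noise_form r s (halfdiff j g) x in par *.
have -> : D = (a ^+ 2 + b ^+ 2) / 2 - A by rewrite par; field.
move=> H; rewrite -subr_ge0; move: H; rewrite -subr_ge0.
by rewrite -/r; congr (0 <= _); field.
Qed.

(** The base case is Parseval; each listed coordinate lying in [S] then contributes one factor
    [r]. *)
Lemma expect_noise_form (r : R) s g :
  expect (noise_form r s g) = \sum_(S : {set _}) r ^+ count (mem S) s * fourier g S ^+ 2.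
Proof.
elim: s g => [|j s IH] g /=.
  by rewrite (parseval g); apply: eq_bigr => S _; rewrite expr0 mul1r.
rewrite expectD expectZ !IH mulr_sumr -big_split; apply: eq_bigr => S _.
rewrite fourier_avg fourier_halfdiff /=.
by case: (j \in S);
  rewrite /= ?mul0r ?mul1r ?expr0n ?mulr0 ?addr0 ?add0r ?add1n ?add0n ?exprS //= mulrA.
Qed.

Lemma fourier_avgs s g S : fourier (avgs s g) S = (~~ has (mem S) s)%:R * fourier g S.
Proof.
elim: s g => [|j s IH] g /=; first by rewrite mul1r.
by rewrite IH fourier_avg negb_or mulrA -natrM mulnb andbC.
Qed.

Lemma avgs_enum g x : avgs (enum 'I_n) g x = expect g.
Proof.
rewrite fourier_inversion (bigD1 finset.set0) //= fourier_avgs fourier_set0 chi0.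
rewrite big1 ?addr0 => [|S /set0Pn[j jS]].
  rewrite (_ : has _ _ = false) ?mul1r ?mulr1 //.
  by apply/hasP => -[j _]; rewrite /= inE.
rewrite fourier_avgs (_ : has _ _ = true) ?mul0r //.
by apply/hasP; exists j; rewrite ?mem_enum.
Qed.

End Hypercontractivity.

(** * Weighted Fourier mass: products, and the bound for a single factor *)

Section FourierMass.
Context {R : realType} {n : nat}.
Implicit Types (f g : cube n -> R) (S T : {set 'I_n}) (x : cube n) (z : R).

Definition mass z f := \sum_(S : {set 'I_n}) `|fourier f S| * z ^+ #|S|.

Lemma mass_ge0 z f : 0 <= z -> 0 <= mass z f.
Proof. by move=> z0; apply: sumr_ge0 => S _; rewrite mulr_ge0 ?exprn_ge0. Qed.

Lemma eq_mass z f g : f =1 g -> mass z f = mass z g.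
Proof. by move=> fg; apply: eq_bigr => S _; rewrite (eq_fourier _ fg). Qed.

Lemma massZ z (c : R) f : mass z (fun x => c * f x) = `|c| * mass z f.
Proof.
by rewrite /mass mulr_sumr; apply: eq_bigr => S _; rewrite fourierZ normrM mulrA.
Qed.

Lemma mass_chi z T : mass z (chi R T) = z ^+ #|T|.
Proof.
rewrite /mass (bigD1 T) //= big1 ?addr0 => [|S /negbTE nST]; rewrite fourier_chi.
  by rewrite eqxx normr1 mul1r.
by rewrite nST normr0 mul0r.
Qed.

Lemma mass_sum z (J : finType) (F : J -> cube n -> R) : 0 <= z ->
  mass z (fun x => \sum_i F i x) <= \sum_i mass z (F i).
Proof.
move=> z0; rewrite /mass [leRHS]exchange_big; apply: ler_sum => S _.
by rewrite fourier_sum -mulr_suml ler_wpM2r ?exprn_ge0 // ler_norm_sum.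
Qed.

(** Expand both factors. If the coefficients at S and T are both nonzero, then S and T are disjoint,
    since no coordinate influences both functions; hence the product of characters is that of a set
    of size |S| + |T|, and the triangle inequality finishes. *)
Lemma massM_le z f g : 0 <= z ->
    (forall j, f \o flip j =1 f \/ g \o flip j =1 g) ->
  mass z (fun x => f x * g x) <= mass z f * mass z g.
Proof.
move=> z0 fg.
pose F (p : {set 'I_n} * {set 'I_n}) x :=
  fourier f p.1 * fourier g p.2 * (chi R p.1 x * chi R p.2 x).
rewrite (@eq_mass _ _ (fun x => \sum_p F p x)); last first.
  move=> x; rewrite {1}fourier_inversion [X in _ * X]fourier_inversion big_distrlr pair_bigA.
  by apply: eq_bigr => -[S T] _; rewrite /F /=; ring.
apply: (le_trans (mass_sum _ z0)).
have -> : mass z f * mass z g =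
    \sum_p `|fourier f p.1| * z ^+ #|p.1| * (`|fourier g p.2| * z ^+ #|p.2|).
  by rewrite /mass big_distrlr pair_bigA.
apply: ler_sum => -[S T] _ /=.
rewrite massZ normrM (eq_mass _ (chiM S T)) mass_chi.
rewrite mulrACA -exprD.
have [->|fS] := eqVneq (fourier f S) 0; first by rewrite normr0 !mul0r.
have [->|gT] := eqVneq (fourier g T) 0; first by rewrite normr0 mulr0 !mul0r.
have ST : [disjoint S & T].
  rewrite -finset.setI_eq0; apply/set0Pn => -[j]; rewrite inE => /andP[jS jT].
  by case: (fg j) => inv; [move/eqP: fS | move/eqP: gT]; apply; apply: fourier_eq0 inv _.
have TS : [disjoint T & S] by rewrite disjoint_sym.
by rewrite (finset.setDidPl ST) (finset.setDidPl TS) cardsU (disjoint_setI0 ST) cards0 subn0.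
Qed.

Lemma mass_prod_le z (J : eqType) (s : seq J) (F : J -> cube n -> R) : 0 <= z -> uniq s ->
    (forall i i' j, i != i' -> F i \o flip j =1 F i \/ F i' \o flip j =1 F i') ->
  mass z (fun x => \prod_(i <- s) F i x) <= \prod_(i <- s) mass z (F i).
Proof.
move=> z0 + Finv; elim: s => [_|i s IH /=/andP[nis us]].
  rewrite big_nil (@eq_mass _ _ (chi R finset.set0)) ?mass_chi ?cards0 // => x.
  by rewrite big_nil chi0.
rewrite big_cons (@eq_mass _ _ (fun x => F i x * \prod_(i <- s) F i x)); last first.
  by move=> x; rewrite big_cons.
apply: le_trans (massM_le z0 _) _; last by rewrite ler_wpM2l ?mass_ge0 // IH.
(* If [F i] depends on [j], then no other factor does, so neither does the remaining product. *)
move=> j; case: (pselect (F i \o flip j =1 F i)) => [|Fij]; first by left.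
right => x /=; apply: eq_big_seq => i' i's.
have ii' : i != i' by apply: contraNneq nis => ->.
by case: (Finv i i' j ii') => [/Fij//|]; exact.
Qed.

Lemma fourier_weight1_le (z : R) d f : 0 < z -> fourier_weight 1 d f <= z ^- d * mass z f.
Proof.
move=> z0; rewrite mulrC ler_pdivlMr ?exprn_gt0 // /mass (bigID (fun S => #|S| == d)) /=.
rewrite ler_wpDr ?sumr_ge0 // => [S _|]; first by rewrite mulr_ge0 ?exprn_ge0 ?(ltW z0).
by rewrite /fourier_weight mulr_suml; apply: ler_sum => S /eqP ->; rewrite powRr1.
Qed.

Lemma sum_subset_expr (I : {set 'I_n}) (w : R) :
  \sum_(S : {set 'I_n} | S \subset I) w ^+ #|S| = (1 + w) ^+ #|I|.
Proof.
transitivity (\prod_i (1 + (if i \in I then w else 0))).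
  rewrite -sum_prod_set big_mkcond; apply: eq_bigr => S _.
  case: ifPn => [SI|/fintype.subsetPn[i iS iI]].
    by rewrite (eq_bigr (fun=> w)) ?prodr_const // => i /(fintype.subsetP SI) ->.
  by rewrite (bigD1 i) //= (negbTE iI) mul0r.
rewrite -prodr_const [RHS]big_mkcond.
by apply: eq_bigr => i _; case: (i \in I); rewrite ?addr0.
Qed.

(** From exp(-1/2) >= 1 - 1/2, squared. *)
Lemma expR1_le4 : expR 1 <= 4 :> R.
Proof.
have h := expR_ge1Dx (- 2^-1 : R).
have e : expR (- 2^-1 : R) ^+ 2 * expR 1 = 1.
  by rewrite -expRM_natr -expRD (_ : - 2^-1 * 2%:R + 1 = 0) ?expR0 //; field.
have h2 : 4^-1 <= expR (- 2^-1 : R) ^+ 2.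
  by rewrite -[4^-1](_ : 2^-1 ^+ 2 = 4^-1) ?ler_sqr ?nnegrE ?expR_ge0 //; [lra | field].
rewrite -(ler_pM2l (x := 4^-1)) ?invr_gt0 // mulVf ?pnatr_eq0 // -[leRHS]e.
by rewrite ler_wpM2r ?expR_ge0.
Qed.

(** The power is at most exp(wm) = 1 / exp(-wm) <= 1 / (1 - 1/196) = 196/195. *)
Lemma exprD1_le w (m : nat) : 0 <= w -> w * m%:R <= 196^-1 -> (1 + w) ^+ m <= 1 + 100^-1 :> R.
Proof.
move=> w0 wm.
have h1 : (1 + w) ^+ m <= expR (w * m%:R).
  by rewrite expRM_natr lerXn2r ?nnegrE ?expR_ge0 ?addr_ge0 ?expR_ge1Dx.
apply: (le_trans h1).
have e : expR (w * m%:R) * expR (- (w * m%:R)) = 1 by rewrite -expRD subrr expR0.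
have := expR_ge1Dx (- (w * m%:R)); have := expR_gt0 (w * m%:R).
move: e; set u := expR _; set v := expR _ => e u0 h.
have : 195 / 196 <= v by lra.
nra.
Qed.

(** Let N be the norm on the left. If N > 10 dl >= exp(-L), then N^(1/L) >= 1/e >= 1/4.
    Hypercontractivity with p = 1 + 1/L gives N N^(1/L) <= E g^p <= E g, as g lies in [0,1]; hence N
    <= 4 E g. *)
Lemma noise_norm_le (L dl : R) g x : 1 <= L -> 0 < dl -> expR (- L) <= 10 * dl ->
    (forall x, 0 <= g x <= 1) ->
  Num.sqrt (noise_form (L^-1 / 4) (enum 'I_n) g x) <= 10 * (expect g + dl).
Proof.
move=> L1 dl0 eL g01.
have L0 : 0 < L by lra.
have Li : 0 < L^-1 <= 1 by rewrite invr_gt0 L0 invf_le1.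
have /andP[Li0 Li1] := Li.
have a0 : 0 <= expect g.
  by rewrite -(expect_cst (n := n) (0 : R)); apply: expect_le => y; case/andP: (g01 y).
have := @hypercontractive R n (1 + L^-1) (enum 'I_n) g x ltac:(lra).
rewrite avgs_enum (_ : 1 + L^-1 - 1 = L^-1); last by ring.
set N := Num.sqrt _ => hN.
have [|NL] := leP N (10 * dl); first by move=> ?; lra.
have {}hN : N * N `^ L^-1 <= expect g.
  have N0 : 0 < N by lra.
  rewrite -[X in X * _]powRr1 ?(ltW N0) // -powRD ?(gt_eqF N0) ?implybT //.
  apply: le_trans hN _; apply: expect_le => y; have /andP[g0 g1] := g01 y.
  rewrite ger0_norm //; apply: le_trans (_ : g y `^ 1 <= _); last by rewrite powRr1.
  have [->|gy] := eqVneq (g y) 0; first by rewrite !powR0 ?oner_eq0 // gt_eqF //; lra.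
  by rewrite ger_powR //; [rewrite lt_neqAle eq_sym gy g0 | lra].
have : 4^-1 <= N `^ L^-1.
  apply: (@le_trans _ _ (expR (- L) `^ L^-1)).
    rewrite -expRM mulNr mulfV ?gt_eqF // expRN lef_pV2 ?posrE ?expR_gt0 //.
    exact: expR1_le4.
  by apply: ge0_ler_powR; rewrite ?nnegrE ?expR_ge0 ?sqrtr_ge0 ?(ltW Li0) //; lra.
by nra.
Qed.

Lemma amgm (X Y lam t : R) : 0 <= X -> 0 <= Y -> 0 < lam -> t ^+ 2 = X * Y ->
  t <= (X / lam + lam * Y) / 2.
Proof.
move=> X0 Y0 lam0 tXY; apply: le_trans (ler_norm t) _.
have A0 : 0 <= X / lam by rewrite divr_ge0 // ltW.
have B0 : 0 <= lam * Y by rewrite mulr_ge0 // ltW.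
have tAB : t ^+ 2 = (X / lam) * (lam * Y) by rewrite tXY; field; rewrite gt_eqF.
rewrite -ler_sqr ?nnegrE ?divr_ge0 ?addr_ge0 // real_normK ?num_real // tAB.
have := sqr_ge0 (X / lam - lam * Y); nra.
Qed.

(** Each term is the geometric mean of r^|S| g^_S^2 and w^|S|, where z^2 = r w; sets not inside [I]
    contribute nothing. The first family sums to at most N^2 and the second to at most 1/100. AM-GM
    with weight 10 N balances the two at N/10 each. *)
Lemma fourier_tail_le (L dl z : R) (m : nat) (I : {set 'I_n}) g :
    1 <= L -> 0 < dl -> expR (- L) <= 10 * dl -> (0 < m)%N -> (#|I| <= m)%N ->
    0 <= z -> z ^+ 2 = (784 * (m%:R * L))^-1 ->
    (forall j, j \notin I -> g \o flip j =1 g) -> (forall x, 0 <= g x <= 1) ->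
  \sum_(S : {set 'I_n} | S != finset.set0) `|fourier g S| * z ^+ #|S| <= expect g + dl.
Proof.
move=> L1 dl0 eL m0 Im z0 zE ginv g01.
have L0 : 0 < L by lra.
have M0 : 0 < m%:R :> R by rewrite ltr0n.
(* Here 784 = 4 * 196: the 4 comes from the two-point inequality, and 196 makes the subset sum below
   at most 1/100. *)
pose r := L^-1 / 4; pose w : R := (196 * m%:R)^-1.
have r0 : 0 < r by rewrite divr_gt0 ?invr_gt0.
have w0 : 0 < w by rewrite invr_gt0 mulr_gt0.
have zrw : z ^+ 2 = r * w by rewrite zE /r /w; field; rewrite !gt_eqF.
have a0 : 0 <= expect g.
  by rewrite -(expect_cst (n := n) (0 : R)); apply: expect_le => y; case/andP: (g01 y).
pose N := 10 * (expect g + dl).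
have N0 : 0 < N by rewrite mulr_gt0 //; lra.
have Qle : \sum_(S : {set 'I_n}) r ^+ #|S| * fourier g S ^+ 2 <= N ^+ 2.
  have -> : \sum_(S : {set 'I_n}) r ^+ #|S| * fourier g S ^+ 2
      = expect (noise_form r (enum 'I_n) g).
    rewrite expect_noise_form; apply: eq_bigr => S _; congr (r ^+ _ * _).
    by rewrite cardE enumT size_filter.
  rewrite -(expect_cst (n := n) (N ^+ 2)); apply: expect_le => x.
  rewrite -[leLHS]sqr_sqrtr ?(noise_form_ge0 _ _ _ (ltW r0)) //.
  by rewrite ler_sqr ?nnegrE ?sqrtr_ge0 ?(ltW N0) // noise_norm_le.
have Wle : \sum_(S : {set 'I_n} | (S != finset.set0) && (S \subset I)) w ^+ #|S| <= 100^-1.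
  have h : (1 + w) ^+ #|I| <= 1 + 100^-1.
    apply: exprD1_le; first exact: ltW.
    apply: (@le_trans _ _ (w * m%:R)); first by rewrite ler_wpM2l ?ler_nat ?(ltW w0).
    by rewrite /w invfM mulfVK ?gt_eqF.
  move: h; rewrite -sum_subset_expr (bigD1 finset.set0) ?finset.sub0set //= cards0 expr0.
  by rewrite lerD2l; under eq_bigl do rewrite andbC.
have l0 : 0 < 10 * N by rewrite mulr_gt0.
have A0 S : 0 <= r ^+ #|S| * fourier g S ^+ 2 by rewrite mulr_ge0 ?sqr_ge0 ?exprn_ge0 ?(ltW r0).
have step S : S != finset.set0 -> `|fourier g S| * z ^+ #|S|
    <= (r ^+ #|S| * fourier g S ^+ 2 / (10 * N)
        + 10 * N * (if S \subset I then w ^+ #|S| else 0)) / 2.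
  move=> _; case: (boolP (S \subset I)) => [SI|/fintype.subsetPn[j jS jI]].
    apply: amgm => //; first by rewrite exprn_ge0 ?(ltW w0).
    rewrite exprMn real_normK ?num_real // -exprM mulnC exprM zrw (exprMn _ r w).
    by rewrite mulrA [X in X * _]mulrC.
  by rewrite (fourier_eq0 (ginv j jI) jS) normr0 mul0r expr0n !mulr0 mul0r addr0 mul0r.
apply: le_trans (ler_sum _ step) _.
rewrite -mulr_suml big_split -mulr_suml -mulr_sumr -big_mkcondr /=.
have {}Qle : \sum_(S : {set 'I_n} | S != finset.set0) r ^+ #|S| * fourier g S ^+ 2 <= N ^+ 2.
  by apply: le_trans Qle; rewrite [leRHS](bigD1 finset.set0) //= lerDr.
have h1 := @ler_wpM2r _ (10 * N)^-1 _ _ _ Qle.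
have h2 := @ler_wpM2l _ (10 * N) _ _ _ Wle.
have {}h1 := h1 ltac:(by rewrite invr_ge0 ltW); have {}h2 := h2 (ltW l0).
have e1 : N ^+ 2 / (10 * N) = expect g + dl.
  have -> : N ^+ 2 / (10 * N) = N / 10 by field; rewrite gt_eqF.
  by rewrite /N; field.
have e2 : 10 * N * 100^-1 = expect g + dl by rewrite /N; field.
rewrite e1 in h1; rewrite e2 in h2; lra.
Qed.

(** With g = (1 - f)/2, the empty set contributes 1 - 2 E g and the tail at most 2 (E g + dl), so
    the mean of g cancels. *)
Lemma mass_bounded_le (L dl z : R) (m : nat) (I : {set 'I_n}) f :
    1 <= L -> 0 < dl -> expR (- L) <= 10 * dl -> (0 < m)%N -> (#|I| <= m)%N ->
    0 <= z -> z ^+ 2 = (784 * (m%:R * L))^-1 ->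
    (forall j, j \notin I -> f \o flip j =1 f) -> (forall x, -1 <= f x <= 1) ->
  mass z f <= 1 + 2 * dl.
Proof.
move=> L1 dl0 eL m0 Im z0 zE finv f1.
(* Negating f preserves its mass; a nonnegative mean gives |E f| = 1 - 2 E g. *)
wlog Ef : f finv f1 / 0 <= expect f.
  move=> H; have [|Ef] := leP 0 (expect f); first exact: H.
  have -> : mass z f = mass z (fun x => -1 * f x) by rewrite massZ normrN1 mul1r.
  apply: H => [j jI x|x|] /=; first by have /= -> := finv j jI x.
    by have := f1 x; lra.
  by rewrite expectZ; lra.
pose g x := 2^-1 + - 2^-1 * f x.
have gE S : S != finset.set0 -> fourier f S = -2 * fourier g S.
  move=> S0; rewrite fourierD fourierZ.
  rewrite (_ : fourier (fun=> 2^-1) S = 0); first by field.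
  rewrite (@eq_fourier _ _ _ (fun x => 2^-1 * chi R finset.set0 x)); last first.
    by move=> x; rewrite chi0 mulr1.
  by rewrite fourierZ fourier_chi (negbTE S0) mulr0.
have Eg : expect g = 2^-1 - expect f / 2 by rewrite expectD expect_cst expectZ; field.
have ginv j : j \notin I -> g \o flip j =1 g.
  by move=> jI x; rewrite /= /g; have /= -> := finv j jI x.
have g01 x : 0 <= g x <= 1 by rewrite /g; have := f1 x; lra.
have := fourier_tail_le L1 dl0 eL m0 Im z0 zE ginv g01.
rewrite Eg => H.
rewrite /mass (bigD1 finset.set0) //= cards0 expr0 mulr1 fourier_set0 ger0_norm //.
rewrite (eq_bigr (fun S => 2 * (`|fourier g S| * z ^+ #|S|))) => [|S S0].
  by rewrite -mulr_sumr; lra.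
by rewrite (gE _ S0) normrM normrN (ger0_norm (ler0n _ 2)) mulrA.
Qed.

End FourierMass.

(** * Choice of parameters and assembly over the blocks *)

Theorem theorem1p4 (R : realType) (n m k : nat)
  (n_gt0 : (0 < n)%N) (m_gt0 : (0 < m)%N) (k_gt0 : (0 < k)%N)
  (I : 'I_k -> {set 'I_n})
  (I_disj : forall i j : 'I_k, i != j -> [disjoint I i & I j])
  (I_card : forall i : 'I_k, (#|I i| <= m)%N)
  (fi : forall i : 'I_k, subcube (I i) -> R)
  (fi_range : forall (i : 'I_k) (y : subcube (I i)), -1 <= fi i y <= 1)
  (f : cube n -> R)
  (f_def : forall x : cube n, f x = \prod_(i < k) fi i (cube_restrict x (I i)))
  (d : nat) (d_gt0 : (0 < d)%N) :
  fourier_weight 1 d f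
    <= (85%:R * Num.sqrt (m%:R * ln (4%:R * expR 1 * k%:R))) ^+ d.
Proof.
(* The slack [dl] is chosen so that k factors 1 + 2 dl multiply to at most exp(1/2) <= 2, and [L] so
   that exp(-L) = 1/(4ek) stays below 10 dl. *)
pose L : R := ln (4%:R * expR 1 * k%:R); pose dl : R := (4 * k%:R)^-1.
have K1 : 1 <= k%:R :> R by rewrite ler1n.
have e0 := expR_gt0 (1 : R).
have eL : expR L = 4 * expR 1 * k%:R.
  by rewrite lnK // posrE !mulr_gt0 ?ltr0n.
have L1 : 1 <= L by rewrite -ler_expR eL; nra.
have M0 : 0 < m%:R :> R by rewrite ltr0n.
have dl0 : 0 < dl by rewrite invr_gt0 mulr_gt0 ?ltr0n.
have eLd : expR (- L) <= 10 * dl.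
  rewrite expRN eL /dl; have e1 : 1 <= expR 1 :> R by rewrite -expR0 ler_expR.
  rewrite -[leLHS]mul1r ler_pdivrMr; last by rewrite !mulr_gt0 ?ltr0n.
  rewrite [leRHS](_ : _ = 10 * expR 1); last by field; rewrite gt_eqF //; lra.
  lra.
set s := Num.sqrt _.
have mL0 : 0 < m%:R * L by rewrite mulr_gt0 //; lra.
have s0 : 0 < s by rewrite sqrtr_gt0.
have ss : s ^+ 2 = m%:R * L by rewrite sqr_sqrtr ?(ltW mL0).
(* The factor 28 is the square root of 784. *)
pose z := (28 * s)^-1.
have z0 : 0 < z by rewrite invr_gt0 mulr_gt0.
have zE : z ^+ 2 = (784 * (m%:R * L))^-1.
  by rewrite -ss /z; field; rewrite gt_eqF.
pose F i x := fi i (cube_restrict x (I i)).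
have Finv i j : j \notin I i -> F i \o flip j =1 F i.
  move=> jI x; rewrite /F /=; congr (fi i _); apply/ffunP => -[l lI].
  by rewrite !ffunE /=; case: eqP => // lj; rewrite -lj lI in jI.
have mass_f : mass z f <= \prod_(i < k) mass z (F i).
  rewrite (@eq_mass _ _ _ _ (fun x => \prod_(i < k) F i x)) //.
  apply: mass_prod_le => [||i i' j /I_disj dI]; rewrite ?index_enum_uniq ?(ltW z0) //.
  case: (boolP (j \in I i)) => [jI|/Finv]; last by left.
  by right; apply: Finv; rewrite (disjointFr dI jI).
have prod_le : \prod_(i < k) mass z (F i) <= 2.
  apply: (@le_trans _ _ ((1 + 2 * dl) ^+ k)).
    rewrite -[X in _ ^+ X]card_ord -prodr_const; apply: ler_prod => i _.
    rewrite mass_ge0 ?(ltW z0) //=.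
    apply: (mass_bounded_le L1 dl0 eLd m_gt0 (I_card i) (ltW z0) zE (Finv i)) => x.
    exact: fi_range.
  apply: (@le_trans _ _ (expR (2 * dl * k%:R))).
    by rewrite expRM_natr lerXn2r ?nnegrE ?expR_ge0 ?expR_ge1Dx // addr_ge0 // mulr_ge0 // ltW.
  rewrite -ler_sqr ?nnegrE ?expR_ge0 // -expRM_natr.
  rewrite (_ : 2 * dl * k%:R * 2%:R = 1); last by rewrite /dl; field; rewrite gt_eqF //; lra.
  by apply: le_trans expR1_le4 _; rewrite -natrX ler_nat.
apply: (le_trans (fourier_weight1_le d f z0)).
have zd0 : 0 <= z ^- d by rewrite invr_ge0 exprn_ge0 ?ltW.
apply: (le_trans (ler_wpM2l zd0 (le_trans mass_f prod_le))).
rewrite -exprVn invrK.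
(* Since d >= 1, the total mass bound 2 is at most 2^d and is absorbed into the base, where 28 * 2 =
   56 <= 85. *)
apply: (@le_trans _ _ ((28 * s) ^+ d * 2 ^+ d)).
  rewrite ler_wpM2l ?exprn_ge0 ?mulr_ge0 ?(ltW s0) //.
  by rewrite -[leLHS]expr1 ler_weXn2l ?ler1n.
by rewrite -exprMn lerXn2r ?nnegrE ?mulr_ge0 ?(ltW s0) //; lra.
Qed.
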